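(* For all integers $p\ge0$ and $r\ge1$, $$T(\{1\}_{p-1},\bar 1,\{1\}_{r-1},\bar 1)=\bar T(\{1\}_{r-1},p+1),$$ where by convention $(\{1\}_{-1},\bar 1)$ is the empty string (so for $p=0$ the left side is $T(\{1\}_{r-1},\bar 1)$).
   Context: $\{1\}_a$ denotes the sequence of $a$ ones. For positive integers $k_1,\dots,k_r$, some entries possibly marked with a bar, $T(\ldots):=2^r\sum_{0<n_1<\cdots<n_r}\frac{\prod_{j\text{ barred}}(-1)^{n_j}}{(2n_1-1)^{k_1}(2n_2-2)^{k_2}\cdots(2n_r-r)^{k_r}}$. $\bar T(k_1,\dots,k_r):=T(k_1,\dots,k_{r-1},\overline{k_r})$ (only the last entry barred). *)

(* Defs.v *)
From HB Require Import structures.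
From mathcomp Require Import all_boot all_order all_algebra.
From mathcomp Require Import all_classical all_reals all_analysis.
Set Implicit Arguments. Unset Strict Implicit. Unset Printing Implicit Defensive.
Import Order.TTheory GRing.Theory Num.Theory.
Import numFieldNormedType.Exports.
Local Open Scope classical_set_scope.
Local Open Scope ring_scope.

(* An entry of a T-value: (k, barred). *)
Definition entry := (nat * bool)%type.

Fixpoint Tnest (R : realType) (es : seq entry) (j lo N : nat) : R :=
  match es with
  | [::] => 1
  | e :: es' =>
      \sum_(lo.+1 <= n < N.+1)
        ((if e.2 then (-1) ^+ n else 1) / (2 * n%:R - j%:R) ^+ e.1
         * Tnest R es' j.+1 n N)
  end.

Definition Ttrunc (R : realType) (es : seq entry) (N : nat) : R :=
  2 ^+ size es * Tnest R es 1 0 N.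

Definition T_is (R : realType) (es : seq entry) (l : R) : Prop :=
  ((fun N => Ttrunc R es N) @ \oo --> l).

Definition ones (a : nat) : seq entry := nseq a (1%N, false).

(* Main.v *)
Require Import Defs.
From mathcomp Require Import all_boot all_order all_algebra.
From mathcomp Require Import all_classical all_reals all_analysis.
From mathcomp Require Import ring lra zify.
Set Implicit Arguments. Unset Strict Implicit. Unset Printing Implicit Defensive.
Import Order.TTheory GRing.Theory Num.Theory.
Import numFieldNormedType.Exports.
Local Open Scope classical_set_scope.
Local Open Scope ring_scope.

(** Distributing the signs over the differences of consecutive indices, the
    left-hand side is, up to the factor (-1)^r, the iterated integral over
    [0, 1] of p forms 2dt/(1-t^2) (innermost) followed by r forms 2dt/(1+t^2),
    and the right-hand side that of r forms 2dt/(1+t^2) (innermost) followed by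
    p forms dt/t. The substitution t -> (1-t)/(1+t) reverses the path, fixes
    2dt/(1+t^2) and exchanges 2dt/(1-t^2) with dt/t, hence the equality.

    No integral is needed: cutting the path at t, the path composition formula
    writes the common value as a sum of products of a power series in t and a
    power series in (1-t)/(1+t). The derivative of this sum telescopes to 0, so
    it is constant on (0, 1), and Abel's theorem identifies its limits at 0
    and 1 with the two sides. *)

(** * Truncated T-values as partial sums of power series coefficients *)

Section truncated_sums.
Context {R : realType}.

Definition entry_weight (e : entry) (j n : nat) : R :=
  (if e.2 then (-1) ^+ n else 1) / (2 * n%:R - j%:R) ^+ e.1.

(** [Tnest] peels off the smallest index, whereas integration adds the largest one; the two are
    related by exchanging sums. The bound [n.-1] keeps the inequality strict. *)
Lemma Tnest_rcons (es : seq entry) (e : entry) j lo N :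
  Tnest R (rcons es e) j lo N =
  \sum_(lo.+1 <= n < N.+1) entry_weight e (j + size es) n * Tnest R es j lo n.-1.
Proof.
elim: es j lo => [|e' es IH] j lo /=.
  by rewrite addn0; apply: eq_bigr => n _; rewrite /entry_weight !mulr1.
have L n : (lo < n)%N ->
  entry_weight e' j n * Tnest R (rcons es e) j.+1 n N =
  \sum_(lo.+1 <= i < N.+1 | (n < i)%N)
     entry_weight e' j n
     * (entry_weight e (j.+1 + size es) i * Tnest R es j.+1 n i.-1).
  move=> lon; rewrite IH mulr_sumr (@big_nat_widenl _ _ _ n.+1 lo.+1) //.
  by rewrite ltnS ltnW.
rewrite (eq_big_nat _ _ (fun n lon => L n (andP lon).1)).
rewrite (exchange_big_dep_nat predT) //=.
apply: eq_big_nat => i /andP[loi iN].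
rewrite (ltn_predK loi) mulr_sumr -addSnnS.
rewrite (@big_nat_widen _ _ _ lo.+1 i N.+1) ?ltnS //; last by rewrite ltnW.
by apply: eq_bigr => n _; rewrite mulrCA.
Qed.

(* The coefficients of [b] as a power series in y, divided by 1 - e y. *)
Fixpoint twist (e : R) (b : nat -> R) (i : nat) : R :=
  if i is i'.+1 then e * twist e b i' + b i'.+1 else b 0%N.

Lemma twist1 b n : twist 1 b n = series b n.+1.
Proof.
elim: n => [|n IH]; first by rewrite seriesEnat /= big_nat1.
by rewrite seriesSr -IH /= mul1r.
Qed.

(** With the sign (-1)^n taken out, alternating partial sums obey the recursion of the twist by
    -1. *)
Lemma series_sign (b : nat -> R) n :
  series (fun i => (-1) ^+ i * b i) n.+1 = (-1) ^+ n * twist (-1) b n.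
Proof.
elim: n => [|n IH]; first by rewrite seriesEnat /= big_nat1.
by rewrite seriesSr IH /= exprS; ring.
Qed.

(** The new largest index n is recorded by i = n - (m+1), with m the length of [es], which turns 2n
    - (m+1) into 2i + m+1. Indices n <= m contribute nothing, since m distinct positive integers do
    not fit below n. *)
Lemma Ttrunc_rcons (es : seq entry) (e : entry) (a : nat -> R) :
  (forall N, Ttrunc R es N = series a (N.+1 - size es)%N) ->
  forall N, Ttrunc R (rcons es e) N =
    series (fun i => 2 * (if e.2 then (-1) ^+ (i + (size es).+1) else 1)
                     / (2 * i%:R + (size es).+1%:R) ^+ e.1 * series a i.+1)
           (N.+1 - (size es).+1)%N.
Proof.
move=> aE N; rewrite /Ttrunc size_rcons Tnest_rcons add1n exprS -mulrA mulr_sumr.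
set m := size es in aE *.
have t n : (0 < n)%N -> 2 * (2 ^+ m * (entry_weight e m.+1 n * Tnest R es 1 0 n.-1))
   = 2 * entry_weight e m.+1 n * series a (n - m)%N.
  by move=> n0; have := aE n.-1; rewrite /Ttrunc -/m prednK // => <-; ring.
rewrite mulr_sumr (eq_big_nat _ _
  (F2 := fun n => 2 * entry_weight e m.+1 n * series a (n - m)%N)); last first.
  by move=> n /andP[n0 _]; rewrite t.
have S0 : series a 0%N = 0 by rewrite seriesEnat /= big_nil.
move: (series a) S0 => S S0 {t aE}; rewrite seriesEnat /=.
case: (leqP N m) => Nm.
  rewrite (_ : N.+1 - m.+1 = 0)%N ?[RHS]big_nil; last by lia.
  rewrite big_nat big1 // => n /andP[n0 nN].
  by rewrite (_ : n - m = 0)%N ?S0 ?mulr0 //; lia.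
rewrite (@big_cat_nat _ _ _ m.+1) /=; [|lia|lia].
rewrite big_nat big1 ?add0r; last first.
  move=> n /andP[n0 nN].
  by rewrite (_ : n - m = 0)%N ?S0 ?mulr0 //; lia.
rewrite -{1}[m.+1]add0n big_addn; apply: eq_bigr => i _.
rewrite /entry_weight (_ : i + m.+1 - m = i.+1)%N; last by lia.
congr (_ * _); rewrite mulrA; congr (_ / _ ^+ _).
by rewrite natrD mulrDr; ring.
Qed.

Lemma series_scale (c : R) (b : nat -> R) n :
  series (fun i => c * b i) n = c * series b n.
Proof. by rewrite !seriesEnat /= mulr_sumr. Qed.

Lemma series_signD (b : nat -> R) p n :
  series (fun i => (-1) ^+ (i + p) * b i) n =
  (-1) ^+ p * series (fun i => (-1) ^+ i * b i) n.
Proof.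
rewrite -series_scale; congr (series _ n); apply/funext => i.
by rewrite exprD mulrA; congr (_ * _); rewrite mulrC.
Qed.

(* With m indices, n_m = i + m is recorded by i, so that the coefficient of
   index i belongs to the monomial t^(2 i + m). *)
Definition unit_coef (i : nat) : R := (i == 0%N)%:R.

Fixpoint Tcoef0 (p : nat) : nat -> R :=
  if p is p'.+1 then fun i => 2 / (2 * i%:R + p%:R) * twist 1 (Tcoef0 p') i
  else unit_coef.

(** Coefficients of the iterated integral from 0 of p forms 2dt/(1-t^2) followed by k forms
    2dt/(1+t^2): a twist by 1 or -1 divides by 1-t^2 or 1+t^2, and 2/(2i+p+k) comes from integrating
    t^(2i+p+k-1). *)
Fixpoint Tcoef (p k : nat) : nat -> R :=
  if k is k'.+1 then
    fun i => 2 / (2 * i%:R + (p + k)%:R) * twist (-1) (Tcoef p k') i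
  else Tcoef0 p.

Lemma series_unit_coef n : series unit_coef n.+1 = 1.
Proof.
by rewrite seriesEnat /= big_nat_recl //= big1 ?addr0.
Qed.

Lemma Ttrunc_nil N : Ttrunc R [::] N = series unit_coef (N.+1 - size (@nil entry))%N.
Proof. by rewrite subn0 series_unit_coef /Ttrunc /= expr0 mul1r. Qed.

Lemma Ttrunc_rcons_eq (es : seq entry) (e : entry) (a b : nat -> R) :
  (forall N, Ttrunc R es N = series a (N.+1 - size es)%N) ->
  (forall i, 2 * (if e.2 then (-1) ^+ (i + (size es).+1) else 1)
             / (2 * i%:R + (size es).+1%:R) ^+ e.1 * series a i.+1 = b i) ->
  forall N, Ttrunc R (rcons es e) N = series b (N.+1 - size (rcons es e))%N.
Proof.
move=> aE ab N; rewrite (Ttrunc_rcons _ aE) size_rcons.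
by congr (series _ _); apply/funext.
Qed.

Lemma onesS k : ones k.+1 = rcons (ones k) (1%N, false).
Proof. by rewrite /ones -[in LHS]addn1 nseqD cats1. Qed.

Lemma size_ones k : size (ones k) = k. Proof. exact: size_nseq. Qed.

Lemma Ttrunc_ones p N :
  Ttrunc R (ones p) N = series (Tcoef0 p) (N.+1 - size (ones p))%N.
Proof.
elim: p N => [|p IH] N; first exact: Ttrunc_nil.
rewrite onesS; apply: (Ttrunc_rcons_eq IH) => i /=.
by rewrite size_ones mulr1 expr1 twist1.
Qed.

Definition first_block p : seq entry :=
  if p is p'.+1 then rcons (ones p') (1%N, true) else [::].

Lemma size_first_block p : size (first_block p) = p.
Proof. by case: p => // p; rewrite size_rcons size_ones. Qed.

Lemma Ttrunc_first_block p N :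
  Ttrunc R (first_block p) N =
  series (fun i => (-1) ^+ (i + p) * Tcoef0 p i) (N.+1 - size (first_block p))%N.
Proof.
case: p N => [|p] N.
  rewrite Ttrunc_nil; congr (series _ _); apply/funext => -[|i] /=.
    by rewrite expr0 mul1r.
  by rewrite /unit_coef /= mulr0.
apply: (Ttrunc_rcons_eq (@Ttrunc_ones p)) => i /=.
by rewrite size_ones expr1 twist1; ring.
Qed.

(** The sign depends on the largest index alone. An unbarred entry takes partial sums, and by
    [series_sign] these carry the same sign again, the rest being a twist by -1. *)
Lemma Ttrunc_first_block_ones p k N :
  Ttrunc R (first_block p ++ ones k) N =
  series (fun i => (-1) ^+ (i + p) * Tcoef p k i)
         (N.+1 - size (first_block p ++ ones k))%N.
Proof.
elim: k N => [|k IH] N; first by rewrite cats0 Ttrunc_first_block.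
rewrite onesS -rcons_cat; apply: (Ttrunc_rcons_eq IH) => i /=.
rewrite size_cat size_first_block size_ones addnS expr1 mulr1.
by rewrite series_signD series_sign exprD; ring.
Qed.

(** The final bar cancels the sign (-1)^(i+p) left by the preceding entries, up to the constant
    (-1)^(r+1). *)
Lemma Ttrunc_lhs p r N :
  Ttrunc R (first_block p ++ rcons (ones r) (1%N, true)) N =
  (-1) ^+ r.+1 * series (Tcoef p r.+1) (N.+1 - (p + r.+1))%N.
Proof.
rewrite -rcons_cat -series_scale.
rewrite (Ttrunc_rcons_eq (b := fun i => (-1) ^+ r.+1 * Tcoef p r.+1 i)
  (@Ttrunc_first_block_ones p r)) => [|i /=].
  by rewrite size_rcons size_cat size_first_block size_ones addnS.
rewrite size_cat size_first_block size_ones expr1 series_signD series_sign.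
rewrite -addnS !exprD -[RHS](signrMK p) -[RHS](signrMK i).
by ring.
Qed.

(** One of the p+1 factors of the last denominator completes [Tcoef], with an empty first block; the
    p others remain. *)
Lemma Ttrunc_rhs p r N :
  Ttrunc R (rcons (ones r) (p.+1, true)) N =
  (-1) ^+ r.+1 * series (fun i => Tcoef 0 r.+1 i / (2 * i%:R + r.+1%:R) ^+ p)
                        (N.+1 - r.+1)%N.
Proof.
rewrite -series_scale.
rewrite (Ttrunc_rcons_eq (b := fun i => (-1) ^+ r.+1 *
  (Tcoef 0 r.+1 i / (2 * i%:R + r.+1%:R) ^+ p))
  (@Ttrunc_first_block_ones 0 r)) => [|i /=].
  by rewrite size_rcons size_ones.
rewrite size_ones series_signD series_sign expr0 mul1r exprD add0n.
by rewrite -[RHS](signrMK i) [_ ^+ p.+1]exprS invfM; ring.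
Qed.

End truncated_sums.

(** * Power series inside the unit disk *)

Section power_series.
Context {R : realType}.
Implicit Types (a b : nat -> R) (x y : R).

Lemma eq_cvgn (u v : nat -> R) (l : R) :
  u =1 v -> u @ \oo --> l -> v @ \oo --> l.
Proof. by move=> /funext ->. Qed.

Definition psum a y : R := limn (pseries a y).

Definition cvg_disk a := forall y, `|y| < 1 -> cvgn (pseries a y).

Lemma cvg_disk_bounded a (C : R) : (forall i, `|a i| <= C) -> cvg_disk a.
Proof.
move=> aC y y1; apply: normed_cvg.
apply: (@series_le_cvg _ _ (fun i => C * `|y| ^+ i)).
- by move=> n; exact: normr_ge0.
- by move=> n; rewrite mulr_ge0 ?exprn_ge0 // (le_trans _ (aC 0%N)).
- by move=> n /=; rewrite normrM normrX ler_wpM2r ?exprn_ge0.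
- by apply: is_cvg_geometric_series; rewrite normr_id.
Qed.

Lemma series_natSX_le (q : R) n : 0 <= q -> q < 1 ->
  \sum_(0 <= i < n) i.+1%:R * q ^+ i <= ((1 - q) ^+ 2)^-1.
Proof.
move=> q0 q1; have q1' : 0 < 1 - q by rewrite subr_gt0.
(* Exact identity, by induction: the second summand is the nonnegative tail of the series. *)
suff: \sum_(0 <= i < n) i.+1%:R * q ^+ i
      + q ^+ n * (n%:R * (1 - q) + 1) / (1 - q) ^+ 2 = ((1 - q) ^+ 2)^-1.
  move=> <-; rewrite lerDl !mulr_ge0 ?exprn_ge0 ?invr_ge0 ?exprn_ge0 //.
    by rewrite addr_ge0 // mulr_ge0 // ltW.
  by rewrite ltW.
elim: n => [|n IH]; first by rewrite big_nil expr0 !mul0r !add0r !mul1r.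
rewrite big_nat_recr //= -[RHS]IH [q ^+ n.+1]exprS -!natr1.
by field; rewrite lt0r_neq0.
Qed.

Lemma is_cvg_series_natSX (q : R) : 0 <= q -> q < 1 ->
  cvgn (series (fun i => i.+1%:R * q ^+ i)).
Proof.
move=> q0 q1; apply: nondecreasing_is_cvgn.
  apply/nondecreasing_seqP => n; rewrite seriesSr lerDl.
  by rewrite mulr_ge0 ?exprn_ge0.
exists ((1 - q) ^+ 2)^-1 => _ [n _ <-].
by rewrite seriesEnat; exact: series_natSX_le.
Qed.

(** At a point K with |y| < K < 1 the terms a_n K^n are bounded, so those of the derivative are
    dominated by a multiple of (n+1) (|y|/K)^n, which is summable. *)
Lemma cvg_disk_diffs a : cvg_disk a -> cvg_disk (pseries_diffs a).
Proof.
move=> ta y y1; pose K := (1 + `|y|) / 2.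
have yK : `|y| < K by rewrite /K; lra.
have K0 : 0 < K by apply: le_lt_trans yK.
have K1 : `|K| < 1 by rewrite gtr0_norm // /K; lra.
clearbody K; have [M [Mr Mf]] := cvg_series_bounded (ta K K1).
have {}Mf n : `|a n * K ^+ n| <= `|M| + 1.
  by apply: Mf => //; rewrite (le_lt_trans (ler_norm _)) // ltrDl.
apply: normed_cvg.
apply: (@series_le_cvg _ _
  ((`|M| + 1) / K *: (fun i => i.+1%:R * (`|y| / K) ^+ i))).
- by move=> n; exact: normr_ge0.
- move=> n /=; rewrite !mulr_ge0 ?addr_ge0 ?invr_ge0 ?(ltW K0) //.
  by rewrite exprn_ge0 // divr_ge0 // ltW.
- move=> n /=; rewrite /pseries_diffs !normrM normrX ger0_norm //.
  have := Mf n.+1; rewrite normrM normrX (gtr0_norm K0) => H.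
  rewrite [leRHS](_ : _ = (n.+1%:R * `|y| ^+ n) * ((`|M| + 1) / K ^+ n.+1)).
    rewrite mulrAC ler_wpM2l ?mulr_ge0 ?exprn_ge0 //.
    by rewrite ler_pdivlMr // exprn_gt0.
  by rewrite /GRing.scale /= expr_div_n exprS invfM /GRing.scale /=; ring.
- apply: is_cvg_seriesZ; apply: is_cvg_series_natSX.
    by rewrite divr_ge0 // ltW.
  by rewrite ltr_pdivrMr // mul1r.
Qed.

Lemma is_derive_psum a y : cvg_disk a -> `|y| < 1 ->
  is_derive y (1 : R) (psum a) (psum (pseries_diffs a) y).
Proof.
move=> ta y1; pose K := (1 + `|y|) / 2.
have yK : `|y| < K by rewrite /K; lra.
have K0 : 0 < K by apply: le_lt_trans yK.
have K1 : `|K| < 1 by rewrite gtr0_norm // /K; lra.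
apply: (@pseries_snd_diffs _ _ K); rewrite ?(gtr0_norm K0) //.
- exact: ta.
- exact: cvg_disk_diffs K1.
- by apply: (cvg_disk_diffs (cvg_disk_diffs ta)).
Qed.

Lemma cvg_psum a y : cvg_disk a -> `|y| < 1 -> pseries a y @ \oo --> psum a y.
Proof. by move=> ta y1; exact: ta. Qed.

Lemma cvg_psum_natM a y : cvg_disk a -> `|y| < 1 ->
  pseries (fun i => i%:R * a i) y @ \oo --> y * psum (pseries_diffs a) y.
Proof.
move=> ta y1.
have /= H := pseries_diffs_equiv (cvg_disk_diffs ta y1).
apply: eq_cvgn (cvgMl_tmp (a := y) H) => n /=.
rewrite /pseries /series /= mulr_sumr; apply: eq_bigr => -[|i] _ /=.
  by rewrite !mul0r mulr0.
by rewrite exprS; ring.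
Qed.

Lemma cvg_psum_affineM a y (j : R) : cvg_disk a -> `|y| < 1 ->
  pseries (fun i => (2 * i%:R + j) * a i) y @ \oo -->
  2 * (y * psum (pseries_diffs a) y) + j * psum a y.
Proof.
move=> ta y1.
apply: eq_cvgn (cvgD (cvgMl_tmp (a := 2) (cvg_psum_natM ta y1))
                     (cvgMl_tmp (a := j) (cvg_psum ta y1))) => n /=.
rewrite /pseries /series /= fctE !mulr_sumr -big_split /=; apply: eq_bigr => i _.
by ring.
Qed.

(** Multiplying by 1 - e y undoes the twist. On partial sums the identity is exact once the product
    with e y is taken one term shorter. *)
Lemma psum_twist e b y : cvg_disk b -> cvg_disk (twist e b) -> `|y| < 1 ->
  psum b y = (1 - e * y) * psum (twist e b) y.
Proof.
move=> tb tt y1.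
have Hb : (fun n => pseries b y n.+1) @ \oo --> psum b y.
  by rewrite (cvg_shiftS (pseries b y)); exact: cvg_psum.
apply: (cvg_unique _ Hb) => //.
have H1 : (fun n => pseries (twist e b) y n.+1) @ \oo --> psum (twist e b) y.
  by rewrite (cvg_shiftS (pseries (twist e b) y)); exact: cvg_psum.
rewrite mulrBl mul1r.
apply: eq_cvgn (cvgB H1 (cvgMl_tmp (a := e * y) (cvg_psum tt y1))) => n.
rewrite !fctE /pseries.
elim: n => [|n IH].
  by rewrite /series /= !big_nat1 big_nil mulr0 subr0.
rewrite [RHS]seriesSr -IH [in LHS]seriesSr (seriesSr _ n) /= exprS.
by ring.
Qed.

(** The coefficient [a i] stands for the monomial x^(2i+j). *)
Definition hpsum (j : nat) a x : R := x ^+ j * psum a (x ^+ 2).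

Lemma norm_sqr_lt1 x : `|x| < 1 -> `|x ^+ 2| < 1.
Proof. by move=> x1; rewrite normrX expr_lt1. Qed.

Lemma is_derive_hpsum a j x : cvg_disk a -> `|x| < 1 -> x != 0 ->
  is_derive x (1 : R) (hpsum j a) (x^-1 * hpsum j (fun i => (2 * i%:R + j%:R) * a i) x).
Proof.
move=> ta x1 x0; have y1 := norm_sqr_lt1 x1.
have E := @cvg_lim _ _ _ _ _ _ _ (cvg_psum_affineM (j := j%:R) ta y1).
rewrite {2}/hpsum {1}/psum {}E //.
have DX k : is_derive x (1 : R) (fun z : R => z ^+ k) (k%:R * x ^+ k.-1).
  have := is_deriveX k (is_derive_id x (1 : R)).
  rewrite /GRing.scale /= mulr1 (_ : _ ^+ k = fun z : R => z ^+ k) //.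
  by apply/funext => z; rewrite exprfctE.
have D2 : is_derive (x ^+ 2) (1 : R) (psum a) (psum (pseries_diffs a) (x ^+ 2)).
  exact: is_derive_psum.
have D : is_derive x (1 : R) (hpsum j a) _ :=
  is_deriveM (DX j)
    (@is_derive1_comp R (psum a) (fun z : R => z ^+ 2) x _ _ D2 (DX 2%N)).
apply: (is_derive_eq D); rewrite /GRing.scale /= expr1.
move: {DX D2 D}(psum _ _) (psum _ _) => u v.
case: j => [|j] /=; first by rewrite !mul0r; field.
by rewrite [x ^+ j.+1]exprS; field.
Qed.

End power_series.

(** * Abel's theorem *)

Section abel.
Context {R : realType}.
Implicit Types (a b : nat -> R) (x y : R).

Lemma cvgn_bounded a (l : R) :
  a @ \oo --> l -> exists2 D : R, 0 <= D & forall i, `|a i| <= D.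
Proof.
move=> al; have [M [Mr Mf]] := cvg_seq_bounded (cvgP _ al).
exists (`|M| + 1); first by rewrite addr_ge0.
by move=> i; apply: Mf => //; rewrite (le_lt_trans (ler_norm _)) // ltrDl.
Qed.

Lemma cvg_disk_cvgn a (l : R) : a @ \oo --> l -> cvg_disk a.
Proof. by move=> /cvgn_bounded[D _ /cvg_disk_bounded]. Qed.

(** The terms below N are bounded by D each, the others by eps times a geometric sum; the factor 1 -
    y makes the first part vanish as y tends to 1. *)
Lemma abel_sum_bound (d : nat -> R) (D eps y : R) (N n : nat) :
  0 <= D -> 0 <= eps -> 0 <= y -> y <= 1 ->
  (forall i, d i <= D) -> (forall i, (N <= i)%N -> d i <= eps) ->
  (1 - y) * (\sum_(0 <= i < n) d i * y ^+ i)
  <= eps * (1 - y ^+ n) + (1 - y) * (D *+ minn n N).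
Proof.
move=> D0 e0 y0 y1 dD de; have y1' : 0 <= 1 - y by rewrite subr_ge0.
elim: n => [|n IH]; first by rewrite big_nil min0n mulr0n expr0 subrr !mulr0 addr0.
rewrite big_nat_recr //= mulrDr.
have yn0 : 0 <= y ^+ n by exact: exprn_ge0.
have yn1 : y ^+ n <= 1 by exact: exprn_ile1.
case: (ltnP n N) => nN.
  rewrite (minn_idPl nN); move: IH; rewrite (minn_idPl (ltnW nN)) => IH.
  rewrite [D *+ n.+1]mulrSr [X in _ <= _ + X]mulrDr addrA lerD //.
    rewrite (le_trans IH) // lerD2r ler_wpM2l // lerD2l lerN2 exprS.
    by rewrite ler_piMl.
  rewrite ler_wpM2l // (le_trans (ler_wpM2r yn0 (dD n))) //.
  by rewrite ler_piMr.
rewrite (minn_idPr (leqW nN)); move: IH; rewrite (minn_idPr nN) => IH.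
have := ler_wpM2l y1' (ler_wpM2r yn0 (de _ nN)).
move: IH; rewrite exprS; nra.
Qed.

(** The weights (1-y) y^i have sum 1 and move to infinity as y tends to 1, so the weighted mean of a
    convergent sequence tends to its limit. The general filter lets y be a function of another
    variable, later the square of [cayley t]. *)
Lemma abel_mean (T : Type) (F : set_system T) {FF : Filter F} (z : T -> R) a
    (l : R) :
  a @ \oo --> l -> z @ F --> (1 : R) -> (\forall t \near F, 0 <= z t < 1) ->
  (1 - z t) * psum a (z t) @[t --> F] --> l.
Proof.
move=> al z1 z01.
have [D0 D0_ge0 aD0] := cvgn_bounded al.
pose D := `|l| + D0.
have D_ge0 : 0 <= D by rewrite addr_ge0.
have aD i : `|l - a i| <= D by rewrite (le_trans (ler_normB _ _)) // lerD2l.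
apply/cvgrPdist_le => eps eps0.
have e2 : 0 < eps / 2 by lra.
have [N _ aN] := (cvgrPdist_le _ _).1 al _ e2.
(* An estimate at fixed y, first for partial sums and then in the limit, where the extra term |l|
   y^n disappears. *)
have bound y : 0 <= y -> y < 1 ->
    `|l - (1 - y) * psum a y| <= eps / 2 + (1 - y) * (D *+ N).
  move=> y0 y1; have yn1 : `|y| < 1 by rewrite ger0_norm.
  have C1 : (fun n => `|l - (1 - y) * pseries a y n|) @ \oo --> `|l - (1 - y) * psum a y|.
    apply: cvg_norm; apply: cvgB; first exact: cvg_cst.
    by apply: cvgMl_tmp; exact: cvg_psum (cvg_disk_cvgn al) yn1.
  have C2 : (fun n => `|l| * y ^+ n + (eps / 2 + (1 - y) * (D *+ N))) @ \oo
     --> `|l| * 0 + (eps / 2 + (1 - y) * (D *+ N)).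
    apply: cvgD; last exact: cvg_cst.
    by apply: cvgMl_tmp; exact: cvg_expr.
  have := ler_cvg_to C1 C2; rewrite mulr0 add0r; apply; apply: nearW => n.
  have -> : l - (1 - y) * pseries a y n =
    l * y ^+ n + (1 - y) * (\sum_(0 <= i < n) (l - a i) * y ^+ i).
    rewrite /pseries /series /=; elim: n => [|n IH].
      by rewrite !big_nil expr0; ring.
    rewrite !big_nat_recr //= mulrDr opprD addrA IH exprS; ring.
  rewrite (le_trans (ler_normD _ _)) // normrM normrX (ger0_norm y0) lerD2l.
  rewrite normrM ger0_norm ?subr_ge0 ?(ltW y1) //.
  have := @abel_sum_bound (fun i => `|l - a i|) D (eps / 2) y N n
    D_ge0 (ltW e2) y0 (ltW y1) aD aN.
  move=> H; apply: le_trans (le_trans H _).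
    rewrite ler_wpM2l ?subr_ge0 ?(ltW y1) // (le_trans (ler_norm_sum _ _ _)) //.
    by apply: ler_sum => i _; rewrite normrM normrX (ger0_norm y0).
  rewrite lerD //.
    by rewrite ler_piMr ?(ltW e2) // gerBl exprn_ge0.
  by rewrite ler_wpM2l ?subr_ge0 ?(ltW y1) // ler_wpMn2l // geq_minr.
have C : (fun t => (1 - z t) * (D *+ N)) @ F --> (0 : R).
  rewrite -[X in _ --> X](mul0r (D *+ N)) -(subrr (1 : R)).
  by apply: cvgMr_tmp; apply: cvgB => //; exact: cvg_cst.
near=> t.
have [z0 zl1] : 0 <= z t /\ z t < 1 by apply/andP; near: t.
apply: (le_trans (bound _ z0 zl1)).
have : `|0 - (1 - z t) * (D *+ N)| <= eps / 2.
  by near: t; exact: ((cvgrPdist_le _ _).1 C _ e2).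
rewrite sub0r normrN => /(le_trans (ler_norm _)); lra.
Unshelve. all: by end_near.
Qed.

(** A power series is 1 - y times the power series of its partial sums, that is, their Abel mean. *)
Lemma abel (T : Type) (F : set_system T) {FF : Filter F} (z : T -> R) a
    (l : R) :
  series a @ \oo --> l -> z @ F --> (1 : R) -> (\forall t \near F, 0 <= z t < 1) ->
  psum a (z t) @[t --> F] --> l.
Proof.
move=> al z1 z01.
have tl : twist 1 a @ \oo --> l.
  have -> : twist 1 a = (fun n => series a n.+1) by apply/funext => n; exact: twist1.
  by rewrite (cvg_shiftS (series a)).
have ta : cvg_disk a.
  by apply: (@cvg_disk_cvgn _ 0); apply: cvg_series_cvg_0; exact: cvgP al.
apply: cvg_trans (abel_mean tl z1 z01); apply: near_eq_cvg.
near=> t.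
have [z0 zl1] : 0 <= z t /\ z t < 1 by apply/andP; near: t.
rewrite (psum_twist (e := 1) ta (cvg_disk_cvgn tl)) ?mul1r // ger0_norm //.
Unshelve. all: by end_near.
Qed.

End abel.

(** * Decay of the coefficients and convergence of the series *)

Section decay.
Context {R : realType}.
Implicit Types (a b : nat -> R).

Definition sqrtS (i : nat) : R := Num.sqrt i.+1%:R.

Lemma sqrtS_gt0 i : 0 < sqrtS i.
Proof. by rewrite sqrtr_gt0. Qed.

Lemma sqr_sqrtS i : sqrtS i * sqrtS i = i.+1%:R.
Proof. by rewrite -expr2 sqr_sqrtr. Qed.

Lemma sqrtS_le i j : (i <= j)%N -> sqrtS i <= sqrtS j.
Proof. by move=> ij; rewrite ler_wsqrtr // ler_nat. Qed.

Lemma sum_inv_sqrtS_le i : \sum_(0 <= k < i.+1) (sqrtS k)^-1 <= 2 * sqrtS i.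
Proof.
elim: i => [|i IH]; first by rewrite big_nat1 /sqrtS sqrtr1 invr1; lra.
rewrite big_nat_recr //= (le_trans (lerD IH (lexx _))) //.
have s0 := sqrtS_gt0 i; have t0 := sqrtS_gt0 i.+1.
have st := sqrtS_le (leqnSn i).
have ss := sqr_sqrtS i; have := sqr_sqrtS i.+1.
rewrite -natr1 -ss.
move: (sqrtS i) (sqrtS i.+1) s0 t0 st => s t s0 t0 st E.
(* With t^2 = s^2 + 1 the inequality becomes (t - s)^2 >= 0. *)
rewrite -(ler_pM2r t0) mulrDl mulVf ?gt_eqF //; nra.
Qed.

(** The exponent 1/2 makes the class stable under the recursion of [Tcoef]: a twist loses at most a
    factor of order i+1, since the sums of 1/sqrt(k+1) are O(sqrt(i+1)), and the factor 2/(2i+j)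
    regains it. *)
Definition sqrt_decay a := exists C : R, forall i, `|a i| <= C / sqrtS i.

Lemma sqrt_decay_ge0 a : sqrt_decay a ->
  exists2 C : R, 0 <= C & forall i, `|a i| <= C / sqrtS i.
Proof.
move=> [C aC]; exists C => //.
have := le_trans (normr_ge0 _) (aC 0%N).
by rewrite /sqrtS sqrtr1 divr1.
Qed.

Lemma sqrt_decay_bounded a : sqrt_decay a -> exists C : R, forall i, `|a i| <= C.
Proof.
move=> /sqrt_decay_ge0[C C0 aC]; exists C => i; rewrite (le_trans (aC i)) //.
rewrite ler_pdivrMr ?sqrtS_gt0 // ler_peMr //.
by have := @sqrtS_le 0 i (leq0n _); rewrite {1}/sqrtS sqrtr1.
Qed.

Lemma sqrt_decay_cvg_disk a : sqrt_decay a -> cvg_disk a.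
Proof. by move=> /sqrt_decay_bounded[C /cvg_disk_bounded]. Qed.

Lemma sqrt_decay_cvg0 a : sqrt_decay a -> a @ \oo --> (0 : R).
Proof.
move=> [C aC].
have H : (fun i => C / sqrtS i) @ \oo --> (0 : R).
  rewrite -(mulr0 C); apply: cvgMl_tmp.
  rewrite -sqrtr0.
  apply: (@eq_cvgn _ (fun i => Num.sqrt (harmonic i))) => [i|].
    by rewrite /harmonic /sqrtS sqrtrV.
  apply: continuous_cvg; [exact: sqrt_continuous|exact: cvg_harmonic].
apply/norm_cvg0P; apply: (squeeze_cvgr _ (cvg_cst 0) H).
by apply: nearW => n; rewrite normr_ge0 aC.
Qed.

Lemma norm_twist_le e b i : `|e| <= 1 ->
  `|twist e b i| <= \sum_(0 <= k < i.+1) `|b k|.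
Proof.
move=> e1; elim: i => [|i IH]; first by rewrite big_nat1.
rewrite big_nat_recr //= (le_trans (ler_normD _ _)) // lerD2r normrM.
by rewrite (le_trans _ IH) // ler_piMl.
Qed.

Lemma affine_gt0 i j : (0 < j)%N -> 0 < 2 * i%:R + j%:R :> R.
Proof. by move=> j0; rewrite ltr_wpDl ?ltr0n // mulr_ge0. Qed.

Lemma affine_ge i j : (0 < j)%N -> i.+1%:R <= 2 * i%:R + j%:R :> R.
Proof. by move=> j0; rewrite -natrM -natrD ler_nat; lia. Qed.

Lemma norm_twist_sqrtS (C e : R) b i : `|e| <= 1 ->
  (forall i, `|b i| <= C / sqrtS i) -> 0 <= C ->
  `|twist e b i| <= 2 * C * sqrtS i.
Proof.
move=> e1 bC C0; rewrite (le_trans (norm_twist_le _ _ e1)) //.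
rewrite (@le_trans _ _ (C * \sum_(0 <= k < i.+1) (sqrtS k)^-1)) //.
  by rewrite mulr_sumr; apply: ler_sum => k _.
by rewrite -mulrA mulrCA ler_wpM2l // sum_inv_sqrtS_le.
Qed.

Lemma sqrt_decay_twist (e : R) b j : `|e| <= 1 -> (0 < j)%N -> sqrt_decay b ->
  sqrt_decay (fun i => 2 / (2 * i%:R + j%:R) * twist e b i).
Proof.
move=> e1 j0 /sqrt_decay_ge0[C C0 bC]; exists (4 * C) => i.
have d0 := affine_gt0 i j0; have s0 := sqrtS_gt0 i.
rewrite normrM ger0_norm ?divr_ge0 ?(ltW d0) //.
rewrite (le_trans (ler_wpM2l _ (norm_twist_sqrtS i e1 bC C0))) ?divr_ge0 ?(ltW d0) //.
rewrite mulrAC ler_pdivrMr // [leRHS]mulrAC ler_pdivlMr //.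
have := affine_ge i j0; rewrite -sqr_sqrtS; nra.
Qed.

Lemma sqrt_decay_div a j q : (0 < j)%N -> sqrt_decay a ->
  sqrt_decay (fun i => a i / (2 * i%:R + j%:R) ^+ q).
Proof.
move=> j0 /sqrt_decay_ge0[C C0 aC]; exists C => i.
have d1 : 1 <= 2 * i%:R + j%:R :> R.
  by rewrite (le_trans _ (affine_ge i j0)) // ler1n.
rewrite (le_trans _ (aC i)) // normrM ler_piMr // normfV.
have d2 := exprn_ege1 q d1.
by rewrite invf_le1 ger0_norm // ?(lt_le_trans ltr01 d2) // (le_trans ler01 d2).
Qed.

Lemma sqrt_decay_unit_coef : sqrt_decay (@unit_coef R).
Proof.
exists 1 => -[|i]; rewrite /unit_coef /=.
  by rewrite normr1 /sqrtS sqrtr1 divr1.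
by rewrite normr0 divr_ge0 // ltW // sqrtS_gt0.
Qed.

Lemma sqrt_decay_Tcoef p k : sqrt_decay (@Tcoef R p k).
Proof.
elim: k => [|k IH] /=.
  elim: p => [|p IH] /=; first exact: sqrt_decay_unit_coef.
  by apply: sqrt_decay_twist => //; rewrite normr1.
by apply: sqrt_decay_twist => //; [rewrite normrN1|rewrite addnS].
Qed.

(** The partial sums are bounded by telescoping: s^(-3) <= 4/s - 4/t, where s^2 = i+1 and t^2 =
    i+2. *)
Lemma is_cvg_series_sqrtS3 : cvgn (series (fun i => (i.+1%:R * sqrtS i)^-1)).
Proof.
apply: nondecreasing_is_cvgn.
  apply/nondecreasing_seqP => n; rewrite seriesSr lerDl.
  by rewrite invr_ge0 mulr_ge0 // ltW // sqrtS_gt0.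
exists 4 => _ [n _ <-].
suff H : series (fun i => (i.+1%:R * sqrtS i)^-1) n <= 4 - 4 / sqrtS n.
  rewrite (le_trans H) // gerBl divr_ge0 // ltW //; exact: sqrtS_gt0.
elim: n => [|n IH]; first by rewrite /series /= big_nil /sqrtS sqrtr1; lra.
rewrite seriesSr (le_trans (lerD IH (lexx _))) //.
have s0 := sqrtS_gt0 n; have t0 := sqrtS_gt0 n.+1.
have st := sqrtS_le (leqnSn n).
have ss := sqr_sqrtS n; have := sqr_sqrtS n.+1; have s1 := @sqrtS_le 0 n (leq0n _).
rewrite -[n.+2%:R]natr1 -ss; move: s1; rewrite {1}/sqrtS sqrtr1.
move: (sqrtS n) (sqrtS n.+1) s0 t0 st => s t s0 t0 st s1 E.
suff : (s * s * s)^-1 <= 4 / s - 4 / t by lra.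
have -> : 4 / s - 4 / t = 4 * (t - s) / (s * t) by field; rewrite !gt_eqF.
rewrite ler_pdivlMr ?mulr_gt0 // mulrC ler_pdivrMr ?mulr_gt0 //.
have -> : t - s = (t + s)^-1.
  apply: (mulIf (x := t + s)); rewrite ?gt_eqF ?addr_gt0 // mulVf ?gt_eqF ?addr_gt0 //.
  by rewrite -subr_sqr !expr2 E; ring.
rewrite mulrAC ler_pdivlMr ?addr_gt0 //.
(* As 1 <= s <= t, (t + s) t <= 2 t^2 = 2 s^2 + 2 <= 4 s^2. *)
have H : (t + s) * t <= 4 * (s * s) by nra.
by have := ler_wpM2l (ltW s0) H; lra.
Qed.

Lemma is_cvg_series_le_sqrtS3 a (C : R) :
  (forall i, `|a i| <= C / (i.+1%:R * sqrtS i)) -> cvgn (series a).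
Proof.
move=> aC; apply: normed_cvg.
have p0 i : 0 < i.+1%:R * sqrtS i by rewrite mulr_gt0 // sqrtS_gt0.
apply: (@series_le_cvg _ _ (C *: (fun i => (i.+1%:R * sqrtS i)^-1))).
- by move=> n; exact: normr_ge0.
- by move=> n; rewrite (le_trans _ (aC n)).
- by move=> n /=; exact: aC.
- by apply: is_cvg_seriesZ; exact: is_cvg_series_sqrtS3.
Qed.

(** One power of 2i+j on top of the decay of order 1/2 gives absolute convergence. *)
Lemma is_cvg_series_div a j q : (0 < j)%N -> sqrt_decay a ->
  cvgn (series (fun i => a i / (2 * i%:R + j%:R) ^+ q.+1)).
Proof.
move=> j0 aD; have /sqrt_decay_ge0[C C0 aC] := sqrt_decay_div q j0 aD.
apply: (@is_cvg_series_le_sqrtS3 _ C) => i.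
have d0 := affine_gt0 i j0; have s0 := sqrtS_gt0 i.
rewrite exprSr invfM mulrA normrM [X in _ * X]ger0_norm ?invr_ge0 ?(ltW d0) //.
rewrite [i.+1%:R * _]mulrC invfM mulrA ler_pM // ?invr_ge0 ?(ltW d0) //.
by rewrite lef_pV2 ?posrE // affine_ge.
Qed.

(* Multiplying by 1 + y undoes the twist by -1, so the sums of consecutive
   terms are absolutely summable even though the terms are not. *)
Lemma is_cvg_series_twist b j : (0 < j)%N -> sqrt_decay b ->
  cvgn (series (fun i => 2 / (2 * i%:R + j%:R) * twist (-1) b i)).
Proof.
move=> j0 bD; have e1 : `|-1 : R| <= 1 by rewrite normrN1.
set a := (fun i => _).
have a0 : a @ \oo --> (0 : R) by apply: sqrt_decay_cvg0; exact: sqrt_decay_twist.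
have [C C0 bC] := sqrt_decay_ge0 bD.
have Cs : cvgn (series (fun i => a i + a i.+1)).
  (* Here 10 = 8 + 2: with d = 2i+j, the difference 2/d - 2/(d+2) = 4/(d(d+2)) meets the bound 2 C
     sqrt(i+1) on the twist, and 2/(d+2) meets the new term b_(i+1). *)
  apply: (@is_cvg_series_le_sqrtS3 _ (10 * C)) => i.
  have d0 := affine_gt0 i j0; have d1 := affine_gt0 i.+1 j0.
  have s0 := sqrtS_gt0 i; have si := sqr_sqrtS i.
  have H1 := norm_twist_sqrtS i e1 bC C0.
  have H2 : `|b i.+1| <= C / sqrtS i.
    rewrite (le_trans (bC _)) // ler_wpM2l // lef_pV2 ?posrE ?sqrtS_gt0 //.
    exact: sqrtS_le.
  have dE : 2 * i.+1%:R + j%:R = 2 * i%:R + j%:R + 2 :> R by rewrite -natr1; ring.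
  have di := affine_ge i j0.
  have -> : a i + a i.+1 = 4 / ((2 * i%:R + j%:R) * (2 * i.+1%:R + j%:R)) * twist (-1) b i
     + 2 / (2 * i.+1%:R + j%:R) * b i.+1.
    rewrite /a /=; move: d0 d1; rewrite dE => d0 d1.
    by field; rewrite !gt_eqF.
  rewrite dE in d1 *.
  move: (2 * i%:R + j%:R) d0 d1 di {dE} => d d0 d1; rewrite -si => di.
  have i1 : (d + 2)^-1 <= (sqrtS i * sqrtS i)^-1.
    by rewrite lef_pV2 ?posrE ?mulr_gt0 // (le_trans di) // lerDl.
  have i2 : (d * (d + 2))^-1 <= (sqrtS i * sqrtS i)^-1 * (sqrtS i * sqrtS i)^-1.
    rewrite invfM ler_pM ?invr_ge0 ?(ltW d0) ?(ltW d1) //.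
    by rewrite lef_pV2 ?posrE ?mulr_gt0.
  rewrite [leRHS](_ : _ =
      4 * ((sqrtS i * sqrtS i)^-1 * (sqrtS i * sqrtS i)^-1) * (2 * C * sqrtS i)
      + 2 * (sqrtS i * sqrtS i)^-1 * (C / sqrtS i)); last first.
    by field; rewrite gt_eqF.
  rewrite (le_trans (ler_normD _ _)) // lerD // normrM ler_pM //.
    rewrite ger0_norm ?ler_pM // ?divr_ge0 ?mulr_ge0 ?(ltW d0) ?(ltW d1) //.
    by rewrite invr_ge0 mulr_ge0 ?(ltW d0) ?(ltW d1).
  by rewrite ger0_norm ?ler_pM // ?divr_ge0 ?invr_ge0 ?(ltW d1).
(* The pairwise sums add up to twice the partial sum of [a], minus a_0, plus a_n. *)
have Ca : (fun n => (series (fun i => a i + a i.+1) n + a 0%N - a n) / 2) @ \oo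
    --> (limn (series (fun i => a i + a i.+1)) + a 0%N - 0) / 2.
  apply: cvgMr_tmp; apply: cvgB => //; apply: cvgD; last exact: cvg_cst.
  exact: Cs.
apply: cvgP (eq_cvgn _ Ca) => n.
rewrite /series /=; elim: n => [|n IH]; first by rewrite !big_nil; field.
by rewrite !big_nat_recr //= -IH; field.
Qed.

End decay.

(** * Derivatives of the generating functions and the Cayley map *)

Section derivatives.
Context {R : realType}.
Implicit Types (a b : nat -> R) (x y t : R).

Lemma cvg_psumZ (c : R) a y : cvg_disk a -> `|y| < 1 ->
  pseries (fun i => c * a i) y @ \oo --> c * psum a y.
Proof.
move=> ta y1; apply: eq_cvgn (cvgMl_tmp (a := c) (cvg_psum ta y1)) => n /=.
by rewrite /pseries /series /= mulr_sumr; apply: eq_bigr => i _; rewrite mulrA.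
Qed.

(** The twist may grow like sqrt(i), but it is (2i+1)/2 times a decaying sequence, and multiplying
    coefficients by 2i+1 preserves convergence in the disk. *)
Lemma cvg_disk_twist (e : R) b : `|e| <= 1 -> sqrt_decay b -> cvg_disk (twist e b).
Proof.
move=> e1 /(sqrt_decay_twist e1 (ltn0Sn 0)) /sqrt_decay_cvg_disk.
set a := (fun i => _) => ta y y1.
have ta2 : cvg_disk (fun i => (2 * i%:R + 1) * a i).
  by move=> z z1; exact: cvgP (cvg_psum_affineM (j := 1) ta z1).
rewrite (_ : twist e b = (fun i => 2^-1 * ((2 * i%:R + 1) * a i))).
  exact: cvgP (cvg_psumZ (c := 2^-1) ta2 y1).
apply/funext => i; rewrite /a.
by field; rewrite gt_eqF // (affine_gt0 i (ltn0Sn 0)).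
Qed.

(** Differentiation cancels the denominator 2i+j+1, and the twist supplies 1/(1 - e x^2). *)
Lemma is_derive_hpsum_twist (e : R) b j x : `|e| <= 1 -> sqrt_decay b ->
  0 < x -> x < 1 ->
  is_derive x (1 : R)
    (hpsum j.+1 (fun i => 2 / (2 * i%:R + j.+1%:R) * twist e b i))
    (2 / (1 - e * x ^+ 2) * hpsum j b x).
Proof.
move=> e1 db x0 x1.
have tt := cvg_disk_twist e1 db.
have ta := sqrt_decay_cvg_disk (sqrt_decay_twist e1 (ltn0Sn j) db).
have xn : `|x| < 1 by rewrite gtr0_norm.
have y1 := norm_sqr_lt1 xn.
apply: (is_derive_eq (is_derive_hpsum _ ta xn (lt0r_neq0 x0))).
rewrite /hpsum (psum_twist (e := e) (sqrt_decay_cvg_disk db) tt y1).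
rewrite (_ : (fun i => _) = (fun i => 2 * twist e b i)); last first.
  by apply/funext => i; field; rewrite gt_eqF // affine_gt0.
rewrite {1}/psum (cvg_lim _ (cvg_psumZ (c := 2) tt y1)) // exprS.
have ey : 1 - e * x ^+ 2 != 0.
  rewrite subr_eq0 eq_sym lt_eqF // (le_lt_trans (ler_norm _)) // normrM.
  by rewrite (le_lt_trans _ y1) // ler_piMl.
by field; rewrite ey lt0r_neq0.
Qed.

Lemma is_derive_hpsum_div a j q x : (0 < j)%N -> sqrt_decay a ->
  0 < x -> x < 1 ->
  is_derive x (1 : R) (hpsum j (fun i => a i / (2 * i%:R + j%:R) ^+ q.+1))
    (x^-1 * hpsum j (fun i => a i / (2 * i%:R + j%:R) ^+ q) x).
Proof.
move=> j0 da x0 x1; have xn : `|x| < 1 by rewrite gtr0_norm.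
have ta := sqrt_decay_cvg_disk (sqrt_decay_div q.+1 j0 da).
apply: (is_derive_eq (is_derive_hpsum _ ta xn (lt0r_neq0 x0))).
congr (_ * hpsum j _ x); apply/funext => i.
by rewrite exprS invfM; field; rewrite expf_neq0 gt_eqF // affine_gt0.
Qed.

Lemma hpsum_unit x : hpsum 0 unit_coef x = 1.
Proof.
rewrite /hpsum expr0 mul1r; apply: cvg_lim => //.
rewrite -(cvg_shiftS (pseries _ _)).
apply: (@eq_cvgn _ (fun=> 1)); last exact: cvg_cst.
move=> n; rewrite /pseries /series /= big_nat_recl //= mulr1 /unit_coef /= big1 ?addr0 //.
by move=> i _; rewrite mul0r.
Qed.

Lemma is_derive_hpsum_unit x : is_derive x (1 : R) (hpsum 0 unit_coef) 0.
Proof.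
rewrite (_ : hpsum 0 unit_coef = cst 1); first exact: is_derive_cst.
by apply/funext => z; rewrite hpsum_unit.
Qed.

(** By the product rule each w_m A_m B_(n-m-1) occurs twice with opposite signs, from
    differentiating A_(m+1) and B_(n-m). *)
Lemma is_derive_telescope (A B : nat -> R -> R) (w : nat -> R) t n :
  is_derive t (1 : R) (A 0%N) 0 ->
  (forall m, (m < n)%N -> is_derive t (1 : R) (A m.+1) (w m * A m t)) ->
  is_derive t (1 : R) (B 0%N) 0 ->
  (forall m, (m < n)%N ->
     is_derive t (1 : R) (B (n - m)%N) (- w m * B (n - m.+1)%N t)) ->
  is_derive t (1 : R) (fun t => \sum_(0 <= m < n.+1) A m t * B (n - m)%N t) 0.
Proof.
move=> A0 dA B0 dB.
pose a m : R := if m is m'.+1 then w m' * A m' t else 0.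
pose b m : R := if (m < n)%N then - w m * B (n - m.+1)%N t else 0.
have D (m : 'I_n.+1) : is_derive t (1 : R) (A m * B (n - m)%N)
    (A m t *: b m + B (n - m)%N t *: a m).
  apply: is_deriveM.
    by case: m => -[|m] //= mn; exact: dA.
  rewrite /b; case: ltnP => [mn|nm]; first exact: dB.
  by have -> : (n - m = 0)%N by lia.
have := is_derive_sum D.
rewrite (_ : \sum_(m < n.+1) _ = fun t => \sum_(0 <= m < n.+1) A m t * B (n - m)%N t).
  move=> H; apply: (is_derive_eq H).
  rewrite big_split /= big_ord_recr [X in _ + X]big_ord_recl /=.
  rewrite /b ltnn scaler0 addr0 scaler0 add0r -big_split /= big1 // => i _.
  by rewrite ltn_ord /bump /= add1n /GRing.scale /=; ring.
by rewrite fct_sumE; apply/funext => u; rewrite big_mkord.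
Qed.

Definition cayley t : R := (1 - t) / (1 + t).

Lemma cayley_itv t : 0 < t -> t < 1 -> 0 < cayley t /\ cayley t < 1.
Proof.
move=> t0 t1; have d0 : 0 < 1 + t by lra.
by rewrite /cayley ltr_pdivrMr // divr_gt0 //; [split=> //; lra|lra].
Qed.

Lemma cayleyK t : 0 < t -> cayley (cayley t) = t.
Proof.
move=> t0; rewrite /cayley; field.
by rewrite !gt_eqF //; [lra|lra].
Qed.

Lemma is_derive_cayley t : 0 < t ->
  is_derive t (1 : R) cayley (- 2 / (1 + t) ^+ 2).
Proof.
move=> t0; have d0 : 1 + t != 0 by rewrite gt_eqF //; lra.
have D1 : is_derive t (1 : R) (fun z : R => 1 + z) 1.
  have D : is_derive t (1 : R) (fun z : R => 1 + z) _ :=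
    is_deriveD (is_derive_cst (1 : R) t 1) (is_derive_id t 1).
  by apply: (is_derive_eq D); rewrite add0r.
have D2 : is_derive t (1 : R) (fun z : R => 1 - z) (-1).
  have D : is_derive t (1 : R) (fun z : R => 1 - z) _ :=
    is_deriveB (is_derive_cst (1 : R) t 1) (is_derive_id t 1).
  by apply: (is_derive_eq D); rewrite sub0r.
have D : is_derive t (1 : R) cayley _ := is_deriveM D2 (is_deriveV d0 D1).
by apply: (is_derive_eq D); rewrite /GRing.scale /=; field.
Qed.

Lemma is_derive_comp_cayley (f : R -> R) t (d w : R) : 0 < t ->
  is_derive (cayley t) (1 : R) f d -> d * (- 2 / (1 + t) ^+ 2) = w ->
  is_derive t (1 : R) (fun z => f (cayley z)) w.
Proof.
move=> t0 D <-.
exact: (@is_derive1_comp R f cayley t _ _ D (is_derive_cayley t0)).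
Qed.

End derivatives.

(** * Path composition and the constant sum *)

Section path_composition.
Context {R : realType}.
Implicit Types (a b : nat -> R) (x y t : R).

(* [Afun r m] and [Bfun p l] are the iterated integrals from 0 of the first m
   forms of the right-hand side and of the first l forms of the left-hand side;
   truncated subtraction selects the kind of the last form. *)
Definition Acoef (r m i : nat) : R :=
  Tcoef 0 (minn m r) i / (2 * i%:R + r%:R) ^+ (m - r).

Definition Afun (r m : nat) : R -> R := hpsum (minn m r) (Acoef r m).

Definition Bcoef (p l : nat) : nat -> R := Tcoef (minn l p) (l - p).

Definition Bfun (p l : nat) : R -> R := hpsum l (Bcoef p l).

(** Density of form number m, counted from 0 in the order of the right-hand side; [Bfun] meets the
    same list in reverse, through [cayley]. *)
Definition path_form (r m : nat) t : R :=
  if (m < r)%N then 2 / (1 + t ^+ 2) else t^-1.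

Lemma sqrt_decay_Acoef r m : (0 < r)%N -> sqrt_decay (Acoef r m).
Proof. by move=> r0; exact/sqrt_decay_div/sqrt_decay_Tcoef. Qed.

Lemma sqrt_decay_Bcoef p l : sqrt_decay (Bcoef p l).
Proof. exact: sqrt_decay_Tcoef. Qed.

Lemma Acoef0 r : Acoef r 0 = unit_coef.
Proof. by apply/funext => i; rewrite /Acoef min0n sub0n divr1. Qed.

Lemma Bcoef0 p : Bcoef p 0 = unit_coef.
Proof. by rewrite /Bcoef min0n sub0n. Qed.

Lemma Afun0 r : Afun r 0 = hpsum 0 unit_coef.
Proof. by rewrite /Afun Acoef0 min0n. Qed.

Lemma Bfun0 p : Bfun p 0 = hpsum 0 unit_coef.
Proof. by rewrite /Bfun Bcoef0. Qed.

Lemma norm_opp1_le1 : `|-1 : R| <= 1.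
Proof. by rewrite normrN1. Qed.

Lemma norm_1_le1 : `|1 : R| <= 1.
Proof. by rewrite normr1. Qed.

Lemma is_derive_Afun r m t : (0 < r)%N -> 0 < t -> t < 1 ->
  is_derive t (1 : R) (Afun r m.+1) (path_form r m t * Afun r m t).
Proof.
move=> r0 t0 t1; rewrite /path_form; case: ltnP => mr.
  have E k : (k <= r)%N -> Afun r k = hpsum k (Tcoef 0 k).
    move=> kr; rewrite /Afun (minn_idPl kr); congr (hpsum k _).
    apply/funext => i; rewrite /Acoef (minn_idPl kr).
    by rewrite (_ : k - r = 0)%N ?expr0 ?divr1 //; lia.
  rewrite (E _ mr) (E _ (ltnW mr)).
  have := is_derive_hpsum_twist m norm_opp1_le1 (sqrt_decay_Tcoef 0 m) t0 t1.
  by rewrite mulN1r opprK.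
(* From r on, each form dt/t only adds a factor 2i+r to the denominator. *)
have E q : Afun r (r + q)%N = hpsum r (fun i => Tcoef 0 r i / (2 * i%:R + r%:R) ^+ q).
  rewrite /Afun (minn_idPr (leq_addr _ _)); congr (hpsum r _).
  by apply/funext => i; rewrite /Acoef (minn_idPr (leq_addr _ _)) addKn.
rewrite -(subnKC mr) -addnS !E.
exact: is_derive_hpsum_div (sqrt_decay_Tcoef 0 r) t0 t1.
Qed.

Lemma is_derive_Bfun p l x : 0 < x -> x < 1 ->
  is_derive x (1 : R) (Bfun p l.+1)
    (2 / (1 - (if (l < p)%N then 1 else -1) * x ^+ 2) * Bfun p l x).
Proof.
move=> x0 x1; rewrite /Bfun /Bcoef; case: ltnP => lp.
  rewrite (minn_idPl lp).
  have /eqP -> : (l.+1 - p == 0)%N by rewrite subn_eq0.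
  have /eqP -> : (l - p == 0)%N by rewrite subn_eq0 ltnW.
  exact: is_derive_hpsum_twist norm_1_le1 (sqrt_decay_Tcoef l 0) x0 x1.
rewrite (minn_idPr (leqW lp)) (subSn lp).
have := is_derive_hpsum_twist l norm_opp1_le1 (sqrt_decay_Tcoef p (l - p)) x0 x1.
by rewrite /= addnS subnKC.
Qed.

(** Path composition at t: m forms are integrated from 0 to t, the remaining ones from t to 1, the
    latter read as integrals from 0 to [cayley t]. *)
Definition path_sum (p r : nat) t : R :=
  \sum_(0 <= m < (p + r).+1) Afun r m t * Bfun p (p + r - m) (cayley t).

Lemma is_derive_path_sum p r t : (0 < r)%N -> 0 < t -> t < 1 ->
  is_derive t (1 : R) (path_sum p r) 0.
Proof.
move=> r0 t0 t1; have [s0 s1] := cayley_itv t0 t1.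
apply: (@is_derive_telescope _ (Afun r) (fun l z => Bfun p l (cayley z))
          (fun m => path_form r m t)).
- by rewrite Afun0; exact: is_derive_hpsum_unit.
- by move=> m _; exact: is_derive_Afun.
- rewrite Bfun0; apply: (is_derive_comp_cayley t0 (is_derive_hpsum_unit _)).
  by rewrite mul0r.
- move=> m mn; rewrite -[in X in is_derive _ _ X](subnSK mn) /=.
  apply: (is_derive_comp_cayley t0 (is_derive_Bfun p _ s0 s1)).
  rewrite mulrAC; congr (_ * _); rewrite /path_form.
  (* The last form of this [Bfun] corresponds to form number m. With s = [cayley t], 2ds/(1+s^2) =
     -2dt/(1+t^2) and 2ds/(1-s^2) = -dt/t. *)
  have -> : (p + r - m.+1 < p)%N = ~~ (m < r)%N by apply/idP/idP; lia.
  have d0 : 1 + t != 0 by rewrite gt_eqF //; lra.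
  have t2 : 0 < 1 + t ^+ 2 by rewrite ltr_wpDr ?sqr_ge0.
  case: ltnP => _ /=; rewrite /cayley.
    rewrite mulN1r opprK; field; rewrite d0 gt_eqF //=.
    by rewrite gt_eqF //; nra.
  rewrite mul1r; field; rewrite d0 gt_eqF //=.
  by rewrite gt_eqF //; nra.
Qed.

Lemma path_sum_const p r t u : (0 < r)%N -> 0 < t -> t < 1 -> 0 < u -> u < 1 ->
  path_sum p r t = path_sum p r u.
Proof.
move=> r0; wlog tu : t u / t <= u.
  move=> H t0 t1 u0 u1; case: (leP t u) => [tu|/ltW ut]; first exact: H.
  by symmetry; exact: H.
move=> t0 t1 u0 u1.
have D x : t <= x <= u -> is_derive x (1 : R) (path_sum p r) 0.
  move=> /andP[tx xu]; apply: is_derive_path_sum => //.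
    exact: lt_le_trans tx.
  exact: le_lt_trans u1.
have [||c _] := @MVT_segment R (path_sum p r) (fun=> 0) t u tu.
- by move=> x; rewrite in_itv /= => /andP[tx xu]; apply: D; rewrite !ltW.
- apply: derivable_within_continuous => x; rewrite in_itv /= => xtu.
  by have [] := D x xtu.
- by rewrite mul0r => /eqP; rewrite subr_eq0 => /eqP.
Qed.

End path_composition.

(** * Limits at the two endpoints *)

Section limits.
Context {R : realType}.
Implicit Types (a b : nat -> R) (x y t : R).

Lemma near_cvg (T : Type) (F : set_system T) {FF : Filter F} (f g : T -> R)
    (l : R) : f @ F --> l -> (\forall t \near F, f t = g t) -> g @ F --> l.
Proof. by move=> fl fg; apply: cvg_trans fl; exact: near_eq_cvg. Qed.

Lemma near0_itv : \forall t \near (0 : R)^'+, 0 < t < 1.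
Proof.
near=> t; apply/andP; split; near: t.
  exact: nbhs_right_gt.
exact: nbhs_right_lt.
Unshelve. all: by end_near. Qed.

Lemma cvg_id_at0 : t @[t --> (0 : R)^'+] --> (0 : R).
Proof. by apply: cvg_at_right_filter; exact: cvg_id. Qed.

Lemma cvg_cayley : @cayley R t @[t --> (0 : R)^'+] --> (1 : R).
Proof.
rewrite -[X in _ --> X](_ : (1 - 0) / (1 + 0) = 1 :> R); last first.
  by rewrite subr0 addr0 divr1.
apply: cvgM; first by apply: cvgB; [exact: cvg_cst|exact: cvg_id_at0].
apply: cvgV; first by rewrite addr0.
by apply: cvgD; [exact: cvg_cst|exact: cvg_id_at0].
Qed.

Lemma cvg_cayley_sqr : @cayley R t ^+ 2 @[t --> (0 : R)^'+] --> (1 : R).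
Proof.
rewrite -[X in _ --> X](mulr1 1).
by under eq_fun do rewrite expr2; apply: cvgM; exact: cvg_cayley.
Qed.

Lemma near_cayley_sqr : \forall t \near (0 : R)^'+, 0 <= cayley t ^+ 2 < 1.
Proof.
near=> t; have /andP[t0 t1] : 0 < t < 1 by near: t; exact: near0_itv.
have [s0 s1] := cayley_itv t0 t1.
by rewrite sqr_ge0 expr_lt1 // ltW.
Unshelve. all: by end_near. Qed.

Lemma cvg_cayleyX j : @cayley R t ^+ j @[t --> (0 : R)^'+] --> (1 : R).
Proof.
elim: j => [|j IH]; first by under eq_fun do rewrite expr0; exact: cvg_cst.
rewrite -[X in _ --> X](mulr1 1).
by under eq_fun do rewrite exprS; apply: cvgM => //; exact: cvg_cayley.
Qed.

Lemma cvg_hpsum_cayley a (l : R) j : series a @ \oo --> l ->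
  hpsum j a (cayley t) @[t --> (0 : R)^'+] --> l.
Proof.
move=> al; rewrite -[X in _ --> X]mul1r; apply: cvgM; first exact: cvg_cayleyX.
exact: (abel al cvg_cayley_sqr near_cayley_sqr).
Qed.

(** The coefficients tend to 0, hence so does their Abel mean, whose factor 1 - s^2 at s =
    [cayley t] equals 4t/(1+t)^2. *)
Lemma cvg_mul_hpsum_cayley b j : sqrt_decay b ->
  (fun t : R => t * hpsum j b (cayley t)) @ (0 : R)^'+ --> (0 : R).
Proof.
move=> /sqrt_decay_cvg0 b0.
have H : (1 - cayley t ^+ 2) * psum b (cayley t ^+ 2) @[t --> (0 : R)^'+]
    --> (0 : R).
  exact: (abel_mean b0 cvg_cayley_sqr near_cayley_sqr).
have H1 : (fun t : R => (1 + t) ^+ 2 / 4 * cayley t ^+ j) @ (0 : R)^'+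
    --> (((1 + 0) * (1 + 0)) / 4 * 1 : R).
  apply: cvgM; last exact: cvg_cayleyX.
  apply: cvgMr_tmp; under eq_fun do rewrite expr2.
  by apply: cvgM; (apply: cvgD; [exact: cvg_cst|exact: cvg_id_at0]).
have H2 : (fun t : R => (1 + t) ^+ 2 / 4 * cayley t ^+ j *
    ((1 - cayley t ^+ 2) * psum b (cayley t ^+ 2))) @ (0 : R)^'+ --> (0 : R).
  rewrite -[X in _ --> X](mulr0 ((1 + 0) * (1 + 0) / 4 * 1)).
  by apply: cvgM; [exact: H1|exact: H].
apply: (near_cvg H2).
near=> t; have /andP[t0 t1] : 0 < t < 1 by near: t; exact: near0_itv.
rewrite /hpsum.
rewrite (_ : 1 - cayley t ^+ 2 = 4 * t / (1 + t) ^+ 2).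
  by field; rewrite gt_eqF //; lra.
by rewrite /cayley; field; rewrite gt_eqF //; lra.
Unshelve. all: by end_near. Qed.

Lemma cvg_div_hpsum a j : cvg_disk a ->
  (fun t : R => t^-1 * hpsum j.+1 a t) @ (0 : R)^'+ --> (0 ^+ j * psum a 0 : R).
Proof.
move=> ta.
have X k : t ^+ k @[t --> (0 : R)^'+] --> (0 ^+ k : R).
  elim: k => [|k IH].
    by under eq_fun do rewrite expr0; rewrite expr0; exact: cvg_cst.
  by under eq_fun do rewrite exprS; rewrite exprS; apply: cvgM => //; exact: cvg_id_at0.
have H : (fun t : R => t ^+ j * psum a (t ^+ 2)) @ (0 : R)^'+
    --> (0 ^+ j * psum a 0 : R).
  apply: cvgM; first exact: X.
  have c0 : {for (0 : R), continuous (psum a)}.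
    apply: differentiable_continuous; apply/derivable1_diffP.
    have n01 : `|0 : R| < 1 by rewrite normr0.
    by have [] := is_derive_psum ta n01.
  have X2 : (fun t : R => t ^+ 2) @ (0 : R)^'+ --> (0 : R).
    by rewrite -[X in _ --> X](expr0n _ 2); exact: X.
  exact: (cvg_comp _ _ X2 c0).
apply: (near_cvg H).
near=> t; have /andP[t0 t1] : 0 < t < 1 by near: t; exact: near0_itv.
by rewrite /hpsum [t ^+ j.+1]exprS -[in RHS]mulrA mulKf // gt_eqF.
Unshelve. all: by end_near. Qed.

(** The first factor is O(t) because j > 0, and the second is o(1/t). *)
Lemma cvg_hpsumM_cayley a b j k : sqrt_decay a -> sqrt_decay b -> (0 < j)%N ->
  hpsum j a t * hpsum k b (cayley t) @[t --> (0 : R)^'+] --> (0 : R).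
Proof.
move=> da db; case: j => // j _.
have H : (fun t : R => t^-1 * hpsum j.+1 a t * (t * hpsum k b (cayley t)))
    @ (0 : R)^'+ --> (0 : R).
  rewrite -[X in _ --> X](mulr0 (0 ^+ j * psum a 0)); apply: cvgM.
    exact/cvg_div_hpsum/sqrt_decay_cvg_disk.
  exact: cvg_mul_hpsum_cayley.
apply: (near_cvg H).
near=> t; have /andP[t0 t1] : 0 < t < 1 by near: t; exact: near0_itv.
by field; rewrite gt_eqF.
Unshelve. all: by end_near. Qed.

Lemma cvg_sum0 (T : Type) (F : set_system T) {FF : Filter F} (f : nat -> T -> R) n :
  (forall m, (m < n)%N -> f m t @[t --> F] --> (0 : R)) ->
  \sum_(0 <= m < n) f m t @[t --> F] --> (0 : R).
Proof.
elim: n => [|n IH] H.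
  by under eq_fun do rewrite big_nil; exact: cvg_cst.
rewrite (_ : (fun u => _) = (fun u => \sum_(0 <= m < n) f m u + f n u)); last first.
  by apply/funext => u; rewrite big_nat_recr.
rewrite -[X in _ --> X](addr0 0); apply: cvgD; last exact: H.
by apply: IH => m mn; apply: H; exact: ltnW.
Qed.

Lemma cvgn_subn (u : nat -> R) (l : R) k :
  u @ \oo --> l -> (fun N => u (N.+1 - k)%N) @ \oo --> l.
Proof.
move=> ul; rewrite -(cvg_shiftn k); apply: (@eq_cvgn _ (fun n => u n.+1)) => [n|].
  by rewrite /= -addSn addnK.
by rewrite (cvg_shiftS u).
Qed.

(** As t tends to 0 only the term m = 0 of [path_sum] survives, and Abel's theorem gives l; as t
    tends to 1 only the term m = p + r survives and gives l'. *)
Lemma series_Tcoef_duality p r (l l' : R) : (0 < r)%N ->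
  series (Tcoef p r) @ \oo --> l ->
  series (fun i => Tcoef 0 r i / (2 * i%:R + r%:R) ^+ p) @ \oo --> l' ->
  l = l'.
Proof.
move=> r0 hl hl'; pose n := (p + r)%N.
have Bn : Bcoef p n = @Tcoef R p r.
  by rewrite /Bcoef /n (minn_idPr (leq_addr _ _)) addKn.
have An : @Acoef R r n = (fun i => Tcoef 0 r i / (2 * i%:R + r%:R) ^+ p).
  by apply/funext => i; rewrite /Acoef /n (minn_idPr (leq_addl _ _)) addnK.
(* The constant value; any point of (0, 1) serves. *)
pose E := @path_sum R p r 2^-1.
have L0 : path_sum p r t @[t --> (0 : R)^'+] --> l.
  rewrite (_ : path_sum p r = (fun t => Afun r 0 t * Bfun p (n - 0) (cayley t)
    + \sum_(0 <= m < n) Afun r m.+1 t * Bfun p (n - m.+1) (cayley t))); last first.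
    by apply/funext => t; rewrite /path_sum big_nat_recl.
  rewrite -[X in _ --> X]addr0; apply: cvgD.
    under eq_fun do rewrite Afun0 hpsum_unit mul1r subn0.
    by apply: cvg_hpsum_cayley; rewrite Bn.
  apply: cvg_sum0 => m mn; apply: cvg_hpsumM_cayley.
  - exact: sqrt_decay_Acoef.
  - exact: sqrt_decay_Bcoef.
  - by rewrite leq_min r0.
(* The limit at 1 is taken at 0 after t -> [cayley t], which swaps the roles of the two factors. *)
have L1 : path_sum p r (cayley t) @[t --> (0 : R)^'+] --> l'.
  rewrite (_ : (fun t => _) = (fun t =>
    \sum_(0 <= m < n) Afun r m (cayley t) * Bfun p (n - m) (cayley (cayley t))
    + Afun r n (cayley t) * Bfun p (n - n) (cayley (cayley t)))); last first.
    by apply/funext => t; rewrite /path_sum big_nat_recr.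
  rewrite -[X in _ --> X]add0r; apply: cvgD.
    apply: cvg_sum0 => m mn.
    have : Bfun p (p + r - m) t * Afun r m (cayley t) @[t --> (0 : R)^'+] --> (0 : R).
      apply: cvg_hpsumM_cayley; [exact: sqrt_decay_Bcoef|exact: sqrt_decay_Acoef|].
      by rewrite subn_gt0.
    move=> H; apply: (near_cvg H); near=> t.
    have /andP[t0 t1] : 0 < t < 1 by near: t; exact: near0_itv.
    by rewrite cayleyK // mulrC.
  under eq_fun do rewrite subnn Bfun0 hpsum_unit mulr1.
  by apply: cvg_hpsum_cayley; rewrite An.
have half1 : (2^-1 : R) < 1 by lra.
have C0 : path_sum p r t @[t --> (0 : R)^'+] --> E.
  apply: (near_cvg (cvg_cst E)); near=> t.
  have /andP[t0 t1] : 0 < t < 1 by near: t; exact: near0_itv.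
  by apply: path_sum_const; rewrite ?invr_gt0.
have C1 : path_sum p r (cayley t) @[t --> (0 : R)^'+] --> E.
  apply: (near_cvg (cvg_cst E)); near=> t.
  have /andP[t0 t1] : 0 < t < 1 by near: t; exact: near0_itv.
  have [s0 s1] := cayley_itv t0 t1.
  by apply: path_sum_const; rewrite ?invr_gt0.
by rewrite (cvg_unique _ L0 C0) // (cvg_unique _ L1 C1).
Unshelve. all: by end_near. Qed.

End limits.

(* T({1}_{p-1}, 1bar, {1}_{r-1}, 1bar) = Tbar({1}_{r-1}, p+1);
   for p = 0 the prefix ({1}_{-1}, 1bar) is empty. Both series converge
   (limits of the truncations n_r <= N) to a common value. *)
Theorem mainTheorem13 (R : realType) (p r : nat) (hr : (1 <= r)%N) :
  exists l : R,
    @T_is R ((if p is p'.+1 then rcons (ones p') (1%N, true) else [::])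
              ++ rcons (ones r.-1) (1%N, true)) l
    /\ @T_is R (rcons (ones r.-1) (p.+1, true)) l.
Proof.
have cl : cvgn (series (@Tcoef R p r)).
  case: r hr => // r _ /=; apply: is_cvg_series_twist; first by rewrite addnS.
  exact: sqrt_decay_Tcoef.
have cr : cvgn (series (fun i => @Tcoef R 0 r i / (2 * i%:R + r%:R) ^+ p)).
  (* For p > 0 the extra denominator gives absolute convergence; for p = 0 convergence comes from
     the cancellation in the twisted series. *)
  case: p {cl} => [|q]; last exact: is_cvg_series_div (sqrt_decay_Tcoef 0 r).
  under eq_fun do rewrite expr0 divr1.
  case: r hr => // r _ /=; apply: is_cvg_series_twist; first by rewrite addnS.
  exact: sqrt_decay_Tcoef.
have E := series_Tcoef_duality hr cl cr.
case: r hr cl cr E => // r _ cl cr E.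
exists ((-1) ^+ r.+1 * limn (series (Tcoef p r.+1))); split.
  apply: (@eq_cvgn _ (fun N => (-1) ^+ r.+1 *
    series (Tcoef p r.+1) (N.+1 - (p + r.+1))%N)) => [N|].
    by rewrite -Ttrunc_lhs.
  by apply: cvgMl_tmp; exact: cvgn_subn.
rewrite E; apply: (@eq_cvgn _ (fun N => (-1) ^+ r.+1 *
  series (fun i => Tcoef 0 r.+1 i / (2 * i%:R + r.+1%:R) ^+ p)
         (N.+1 - r.+1)%N)) => [N|].
  by rewrite -Ttrunc_rhs.
by apply: cvgMl_tmp; exact: cvgn_subn cr.
Qed.
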